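(* For every $\boldsymbol x\in[0,1]^{N_\Sigma}$ and every coordinate $(r,i)$ with $1\le r\le R$, $1\le i\le N_r$, $$g_i^{(r)}(\boldsymbol x)=\widehat q_i^{(r)}(\boldsymbol x)+2\gamma_r(\boldsymbol x)\,(\boldsymbol u_i^{(r)})^\top\mathbf R_r(\boldsymbol x)\boldsymbol u_i^{(r)},$$ where $$\widehat q_i^{(r)}=\gamma_r\left[a_i^{(r)}+2b_i^{(r)}\bar y_r+2\mu_rd_i^{(r)}-2a_i^{(r)}(y_i^{(r)}-\bar y_r)\right].$$ Therefore $$|g_i^{(r)}-\widehat q_i^{(r)}|\le\rho_{i,\mathrm{spec}}^{(r)}:=2\gamma_r\|\mathbf R_r\|_2\,d_i^{(r)},$$ equivalently $g_i^{(r)}\in[\widehat q_i^{(r)}-\rho_{i,\mathrm{spec}}^{(r)},\ \widehat q_i^{(r)}+\rho_{i,\mathrm{spec}}^{(r)}]$.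
   Context: Let $R\ge1$. For $r=1,\dots,R$ let $\mathbf U_r\in\mathbb R^{N_r\times K_r}$ have full column rank, with $i$th row $(\boldsymbol u_i^{(r)})^\top$; $N_\Sigma=\sum_rN_r$. Put $a_i^{(r)}=\|\boldsymbol u_i^{(r)}\|_2^4$, $b_i^{(r)}=\sum_{j\ne i}((\boldsymbol u_i^{(r)})^\top\boldsymbol u_j^{(r)})^2$, $d_i^{(r)}=\|\boldsymbol u_i^{(r)}\|_2^2$ and $Z_r=\sum_{i,j=1}^{N_r}((\boldsymbol u_i^{(r)})^\top\boldsymbol u_j^{(r)})^2$. For $\boldsymbol x=(\boldsymbol x^{(1)},\dots,\boldsymbol x^{(R)})\in[0,1]^{N_\Sigma}$ let $\boldsymbol y=\boldsymbol1-\boldsymbol x$, $H_r(\boldsymbol x)=\sum_ia_i^{(r)}y_i^{(r)}+\sum_{i\ne j}((\boldsymbol u_i^{(r)})^\top\boldsymbol u_j^{(r)})^2y_i^{(r)}y_j^{(r)}$, $\widetilde v(\boldsymbol x)=1-\prod_{r=1}^RH_r(\boldsymbol x)/Z_r$, $g_i^{(r)}(\boldsymbol x)=\partial\widetilde v/\partial x_i^{(r)}(\boldsymbol x)$, and $\gamma_r(\boldsymbol x)=\frac1{Z_r}\prod_{s\ne r}\frac{H_s(\boldsymbol x)}{Z_s}$. Further, $\bar y_r=\frac1{N_r}\sum_iy_i^{(r)}$, $\mathbf G_r^{\rm full}=\mathbf U_r^\top\mathbf U_r$, $\mathbf G_r(\boldsymbol x)=\mathbf U_r^\top\operatorname{diag}(\boldsymbol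 y^{(r)})\mathbf U_r$, $\mathbf M_r=\mathbf G_r(\boldsymbol x)-\bar y_r\mathbf G_r^{\rm full}$, $\mu_r=\operatorname{tr}(\mathbf M_r)/K_r$, $\mathbf R_r=\mathbf M_r-\mu_r\mathbf I_{K_r}$; $\|\cdot\|_2$ on matrices is the spectral norm. *)

(* Defs.v *)
From HB Require Import structures.
From mathcomp Require Import all_boot all_order all_algebra.
From mathcomp Require Import boolp classical_sets reals topology normedtype derive.

Set Implicit Arguments.
Unset Strict Implicit.
Unset Printing Implicit Defensive.

Import Order.TTheory GRing.Theory Num.Theory.
Import numFieldNormedType.Exports.

Local Open Scope classical_set_scope.
Local Open Scope ring_scope.

Definition dot (R : realType) (k : nat) (u v : 'cV[R]_k) : R := (u^T *m v) 0 0.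

(* The library norm `|v| on 'cV[R]_k is the sup norm, hence this definition. *)
Definition norm2 (R : realType) (k : nat) (v : 'cV[R]_k) : R :=
  Num.sqrt (\sum_i v i 0 ^+ 2).

(* Operator norm induced by norm2; the set is nonempty and bounded above, so
   that sup is its actual least upper bound. *)
Definition spectral_norm (R : realType) (m n : nat) (A : 'M[R]_(m, n)) : R :=
  sup [set norm2 (A *m v) | v in [set v : 'cV[R]_n | norm2 v <= 1]].

(* Up to Rmat, U is a single factor with rows u_i^T and y is the block of
   1 - x corresponding to that factor. *)

Definition uvec (R : realType) (n k : nat) (U : 'M[R]_(n, k)) (i : 'I_n) :
  'cV[R]_k := (row i U)^T.

Definition acoef (R : realType) (n k : nat) (U : 'M[R]_(n, k)) (i : 'I_n) : R :=
  norm2 (uvec U i) ^+ 4.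

Definition bcoef (R : realType) (n k : nat) (U : 'M[R]_(n, k)) (i : 'I_n) : R :=
  \sum_(j | j != i) dot (uvec U i) (uvec U j) ^+ 2.

Definition dcoef (R : realType) (n k : nat) (U : 'M[R]_(n, k)) (i : 'I_n) : R :=
  norm2 (uvec U i) ^+ 2.

Definition Zconst (R : realType) (n k : nat) (U : 'M[R]_(n, k)) : R :=
  \sum_i \sum_j dot (uvec U i) (uvec U j) ^+ 2.

(* The second sum runs over ordered pairs (i, j) with i <> j. *)
Definition Hpoly (R : realType) (n k : nat) (U : 'M[R]_(n, k)) (y : 'cV[R]_n) : R :=
  \sum_i acoef U i * y i 0
  + \sum_i \sum_(j | i != j) dot (uvec U i) (uvec U j) ^+ 2 * y i 0 * y j 0.

Definition ybar (R : realType) (n : nat) (y : 'cV[R]_n) : R :=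
  (\sum_i y i 0) / n%:R.

Definition Gfull (R : realType) (n k : nat) (U : 'M[R]_(n, k)) : 'M[R]_k :=
  U^T *m U.

Definition Gmat (R : realType) (n k : nat) (U : 'M[R]_(n, k)) (y : 'cV[R]_n) :
  'M[R]_k := U^T *m diag_mx y^T *m U.

Definition Mmat (R : realType) (n k : nat) (U : 'M[R]_(n, k)) (y : 'cV[R]_n) :
  'M[R]_k := Gmat U y - ybar y *: Gfull U.

Definition mu (R : realType) (n k : nat) (U : 'M[R]_(n, k)) (y : 'cV[R]_n) : R :=
  \tr (Mmat U y) / k%:R.

Definition Rmat (R : realType) (n k : nat) (U : 'M[R]_(n, k)) (y : 'cV[R]_n) :
  'M[R]_k := Mmat U y - (mu U y)%:M.

(* The point x = (x^(1), ..., x^(p)) is one column vector of size \sum_r N r;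
   its blocks are given by submxcol, and tagnat.Rank r i is the position of
   coordinate (r, i). *)

Definition yblock (R : realType) (p : nat) (N : 'I_p -> nat)
    (x : 'cV[R]_(\sum_(r < p) N r)) (r : 'I_p) : 'cV[R]_(N r) :=
  submxcol (const_mx 1 - x) r.

(* Defined by its polynomial formula on the whole space, so that the partial
   derivatives below also make sense on the boundary of the cube. *)
Definition vtilde (R : realType) (p : nat) (N K : 'I_p -> nat)
    (U : forall r, 'M[R]_(N r, K r)) (x : 'cV[R]_(\sum_(r < p) N r)) : R :=
  1 - \prod_r (Hpoly (U r) (yblock x r) / Zconst (U r)).

Definition basis_vec (R : realType) (p : nat) (N : 'I_p -> nat)
    (r : 'I_p) (i : 'I_(N r)) : 'cV[R]_(\sum_(s < p) N s) :=
  delta_mx (tagnat.Rank r i) 0.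

Definition gpartial (R : realType) (p : nat) (N K : 'I_p -> nat)
    (U : forall r, 'M[R]_(N r, K r)) (x : 'cV[R]_(\sum_(r < p) N r))
    (r : 'I_p) (i : 'I_(N r)) : R :=
  'D_(basis_vec R i) (vtilde U) x.

Definition gamma (R : realType) (p : nat) (N K : 'I_p -> nat)
    (U : forall r, 'M[R]_(N r, K r)) (x : 'cV[R]_(\sum_(r < p) N r))
    (r : 'I_p) : R :=
  (Zconst (U r))^-1 *
  \prod_(s | s != r) (Hpoly (U s) (yblock x s) / Zconst (U s)).

Definition qhat (R : realType) (p : nat) (N K : 'I_p -> nat)
    (U : forall r, 'M[R]_(N r, K r)) (x : 'cV[R]_(\sum_(r < p) N r))
    (r : 'I_p) (i : 'I_(N r)) : R :=
  let y := yblock x r in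
  gamma U x r *
  (acoef (U r) i + 2 * bcoef (U r) i * ybar y + 2 * mu (U r) y * dcoef (U r) i
   - 2 * acoef (U r) i * (y i 0 - ybar y)).

Definition rho_spec (R : realType) (p : nat) (N K : 'I_p -> nat)
    (U : forall r, 'M[R]_(N r, K r)) (x : 'cV[R]_(\sum_(r < p) N r))
    (r : 'I_p) (i : 'I_(N r)) : R :=
  2 * gamma U x r * spectral_norm (Rmat (U r) (yblock x r)) * dcoef (U r) i.

(* Main.v *)
(* Each H_r is affine in every single coordinate y_i, with slope
   a_i + 2 \sum_(j != i) <u_i, u_j>^2 y_j, so vtilde restricted to a coordinate
   line is affine and its partial derivative is gamma_r times this slope.
   Since u_i^T G_r u_i = \sum_j <u_i, u_j>^2 y_j includes the diagonal term
   a_i y_i, the substitution G_r = ybar G_full + mu I + R_r splits the slope into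
   the bracket defining qhat and 2 u_i^T R_r u_i; Cauchy-Schwarz bounds the
   latter, and gamma_r >= 0 on the cube. *)
Require Import Defs.
From HB Require Import structures.
From mathcomp Require Import all_boot all_order all_algebra.
From mathcomp Require Import boolp classical_sets reals topology normedtype derive.
From mathcomp Require Import ring.

Set Implicit Arguments.
Unset Strict Implicit.
Unset Printing Implicit Defensive.

Import Order.TTheory GRing.Theory Num.Theory.
Import numFieldNormedType.Exports.

Local Open Scope ring_scope.

(** * Euclidean geometry: Cauchy-Schwarz and the spectral norm *)

Lemma dotE (R : realType) (k : nat) (u v : 'cV[R]_k) :
  dot u v = \sum_i u i 0 * v i 0.
Proof. by rewrite /dot mxE; apply: eq_bigr => i _; rewrite mxE. Qed.

Lemma dotC (R : realType) (k : nat) (u v : 'cV[R]_k) : dot u v = dot v u.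
Proof. by rewrite !dotE; apply: eq_bigr => i _; rewrite mulrC. Qed.

Lemma dot_mulmx_tr (R : realType) (m n : nat) (A : 'M[R]_(m, n))
    (u : 'cV[R]_n) (v : 'cV[R]_m) : dot u (A^T *m v) = dot (A *m u) v.
Proof. by rewrite /dot trmx_mul mulmxA. Qed.

Lemma norm2_ge0 (R : realType) (k : nat) (v : 'cV[R]_k) : 0 <= norm2 v.
Proof. exact: sqrtr_ge0. Qed.

Lemma sqr_norm2 (R : realType) (k : nat) (v : 'cV[R]_k) :
  norm2 v ^+ 2 = \sum_i v i 0 ^+ 2.
Proof. by rewrite sqr_sqrtr // sumr_ge0 // => i _; exact: sqr_ge0. Qed.

Lemma dotvv (R : realType) (k : nat) (v : 'cV[R]_k) : dot v v = norm2 v ^+ 2.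
Proof. by rewrite dotE sqr_norm2; apply: eq_bigr => i _. Qed.

Lemma norm2Z (R : realType) (k : nat) (c : R) (v : 'cV[R]_k) :
  norm2 (c *: v) = `|c| * norm2 v.
Proof.
rewrite -sqrtr_sqr -sqrtrM ?sqr_ge0 // mulr_sumr; congr Num.sqrt.
by apply: eq_bigr => i _; rewrite mxE exprMn.
Qed.

Lemma norm2_eq0 (R : realType) (k : nat) (v : 'cV[R]_k) :
  norm2 v = 0 -> v = 0.
Proof.
move=> v0; have /eqP := sqr_norm2 v.
rewrite v0 expr0n /= eq_sym psumr_eq0; last by move=> i _; exact: sqr_ge0.
move=> /allP vi0; apply/matrixP => i j; rewrite (ord1 j) mxE; apply/eqP.
by have := vi0 i (mem_index_enum i); rewrite /= sqrf_eq0.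
Qed.

Lemma sqr_norm2B (R : realType) (k : nat) (c d : R) (u v : 'cV[R]_k) :
  norm2 (c *: u - d *: v) ^+ 2 =
    c ^+ 2 * norm2 u ^+ 2 - 2 * c * d * dot u v + d ^+ 2 * norm2 v ^+ 2.
Proof.
rewrite dotE !sqr_norm2 !mulr_sumr -sumrB -big_split /=.
by apply: eq_bigr => i _; rewrite !mxE; ring.
Qed.

Lemma dot_le_norm2 (R : realType) (k : nat) (u v : 'cV[R]_k) :
  `|dot u v| <= norm2 u * norm2 v.
Proof.
have [v0|v0] := eqVneq (norm2 v) 0.
  by rewrite v0 (norm2_eq0 v0) /dot mulmx0 mxE normr0 mulr0.
have v_gt0 : 0 < norm2 v ^+ 2 by rewrite exprn_gt0 // lt_def v0 norm2_ge0.
(* The discriminant inequality, from expanding | |v|^2 u - <u,v> v |^2. *)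
have : 0 <= norm2 v ^+ 2 * (norm2 u ^+ 2 * norm2 v ^+ 2 - dot u v ^+ 2).
  rewrite [leRHS](_ : _ = norm2 (norm2 v ^+ 2 *: u - dot u v *: v) ^+ 2).
    exact: sqr_ge0.
  by rewrite sqr_norm2B; ring.
rewrite pmulr_rge0 // subr_ge0 -exprMn -[dot u v ^+ 2]real_normK ?num_real //.
by rewrite ler_sqr // nnegrE ?mulr_ge0 ?norm2_ge0.
Qed.

(** Needed so that the supremum in [spectral_norm] is taken over a set bounded above. The constant
    is the Frobenius norm of [A], by Cauchy-Schwarz applied to each row. *)
Lemma norm2_mulmx_bounded (R : realType) (m n : nat) (A : 'M[R]_(m, n)) :
  exists C : R, forall v : 'cV[R]_n, norm2 (A *m v) <= C * norm2 v.
Proof.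
exists (Num.sqrt (\sum_i norm2 (row i A)^T ^+ 2)) => v.
have S_ge0 : 0 <= \sum_i norm2 (row i A)^T ^+ 2.
  by rewrite sumr_ge0 // => i _; exact: sqr_ge0.
rewrite -ler_sqr ?nnegrE ?mulr_ge0 ?norm2_ge0 ?sqrtr_ge0 // exprMn.
rewrite (sqr_norm2 (A *m v)) (sqr_sqrtr S_ge0) mulr_suml; apply: ler_sum => i _.
have -> : (A *m v) i 0 = dot (row i A)^T v.
  by rewrite dotE mxE; apply: eq_bigr => j _; rewrite !mxE.
rewrite -exprMn -[dot _ v ^+ 2]real_normK ?num_real //.
by rewrite ler_sqr ?nnegrE ?mulr_ge0 ?norm2_ge0 ?dot_le_norm2.
Qed.

(** For nonzero [v], the normalised vector lies in the unit ball, so its image has norm at most the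
    supremum; homogeneity then restores the factor [norm2 v]. *)
Lemma norm2_mulmx_le (R : realType) (m n : nat) (A : 'M[R]_(m, n))
    (v : 'cV[R]_n) : norm2 (A *m v) <= spectral_norm A * norm2 v.
Proof.
have [C AC] := norm2_mulmx_bounded A.
(* A zero vector cannot be normalised; there the bound by [C] already forces the left side to be at
   most 0. *)
have [v0|v0] := eqVneq (norm2 v) 0.
  by rewrite v0 mulr0; have := AC v; rewrite v0 mulr0.
have v_gt0 : 0 < norm2 v by rewrite lt_def v0 norm2_ge0.
rewrite -ler_pdivrMr // mulrC -[_^-1]gtr0_norm ?invr_gt0 // -norm2Z scalemxAr.
apply: ub_le_sup.
  (* The absolute value is taken because [C] comes with no sign, and [norm2 w <= 1] can be absorbed
     only by a nonnegative factor. *)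
  exists `|C| => _ [w /= w1 <-]; apply: le_trans (AC w) _.
  apply: le_trans (ler_wpM2r (norm2_ge0 w) (ler_norm C)) _.
  by rewrite ler_piMr.
exists ((norm2 v)^-1 *: v) => //=.
by rewrite norm2Z gtr0_norm ?invr_gt0 // mulVf.
Qed.

Lemma quad_form_le_spectral_norm (R : realType) (k : nat) (A : 'M[R]_k)
    (u : 'cV[R]_k) : `|dot u (A *m u)| <= spectral_norm A * norm2 u ^+ 2.
Proof.
apply: le_trans (dot_le_norm2 _ _) _.
by rewrite mulrC expr2 mulrA ler_wpM2r ?norm2_ge0 ?norm2_mulmx_le.
Qed.

(** * Partial derivatives of [Hpoly] *)

Definition Hpartial (R : realType) (n k : nat) (U : 'M[R]_(n, k))
    (y : 'cV[R]_n) (i : 'I_n) : R :=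
  acoef U i + 2 * \sum_(j | j != i) dot (uvec U i) (uvec U j) ^+ 2 * y j 0.

(* Hpoly has no square monomials, so it is affine in each coordinate. *)
Lemma Hpoly_coord (R : realType) (n k : nat) (U : 'M[R]_(n, k))
    (y : 'cV[R]_n) (i : 'I_n) :
  Hpoly U y = y i 0 * Hpartial U y i
    + (\sum_(l | l != i) acoef U l * y l 0
       + \sum_(l | l != i) \sum_(j | (l != j) && (j != i))
           dot (uvec U l) (uvec U j) ^+ 2 * y l 0 * y j 0).
Proof.
rewrite /Hpoly (bigD1 i) //= [X in _ + X](bigD1 i) //=.
(* The rows [l != i] still meet column [i]. By symmetry of [dot], these terms form a second copy of
   the cross sum of row [i], whence the factor 2 in [Hpartial]. *)
have -> : \sum_(l | l != i) \sum_(j | l != j)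
            dot (uvec U l) (uvec U j) ^+ 2 * y l 0 * y j 0 =
          \sum_(j | j != i) dot (uvec U i) (uvec U j) ^+ 2 * y j 0 * y i 0
          + \sum_(l | l != i) \sum_(j | (l != j) && (j != i))
           dot (uvec U l) (uvec U j) ^+ 2 * y l 0 * y j 0.
  rewrite -big_split; apply: eq_bigr => l li /=.
  by rewrite (bigD1 i) //= dotC.
rewrite /Hpartial -mulr_suml.
have -> : \sum_(j | i != j) dot (uvec U i) (uvec U j) ^+ 2 * y i 0 * y j 0 =
   (\sum_(j | j != i) dot (uvec U i) (uvec U j) ^+ 2 * y j 0) * y i 0.
  rewrite mulr_suml; apply: eq_big => [j|j _]; first by rewrite eq_sym.
  by ring.
by ring.
Qed.

(** Exact for every [t], since neither [Hpartial U y i] nor the remainder in [Hpoly_coord] involves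
    [y i 0]. *)
Lemma Hpoly_add_delta (R : realType) (n k : nat) (U : 'M[R]_(n, k))
    (y : 'cV[R]_n) (i : 'I_n) (t : R) :
  Hpoly U (y + t *: delta_mx i 0) = Hpoly U y + t * Hpartial U y i.
Proof.
set z := y + _.
have zi : z i 0 = y i 0 + t by rewrite !mxE !eqxx mulr1.
have zj j : j != i -> z j 0 = y j 0.
  by move=> /negPf ji; rewrite !mxE ji mulr0 addr0.
have zP : Hpartial U z i = Hpartial U y i.
  by congr (_ + 2 * _); apply: eq_bigr => j ji; rewrite zj.
rewrite (Hpoly_coord U z i) (Hpoly_coord U y i) zi zP mulrDl addrAC.
congr (_ + _ + _); congr (_ + _); first by apply: eq_bigr => j ji; rewrite zj.
by apply: eq_bigr => l li; apply: eq_bigr => j /andP[_ ji]; rewrite !zj.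
Qed.

(** * Quadratic forms of [Gmat], [Gfull] and [Rmat] *)

Lemma dot_mul_Gmat (R : realType) (n k : nat) (U : 'M[R]_(n, k))
    (y : 'cV[R]_n) (u : 'cV[R]_k) :
  dot u (Gmat U y *m u) = \sum_j dot u (uvec U j) ^+ 2 * y j 0.
Proof.
rewrite /Gmat -!mulmxA dot_mulmx_tr dotE; apply: eq_bigr => j _.
rewrite mul_diag_mx !mxE.
have -> : \sum_l U j l * u l 0 = dot u (uvec U j).
  by rewrite dotE; apply: eq_bigr => l _; rewrite !mxE mulrC.
by ring.
Qed.

Lemma dot_mul_Gfull (R : realType) (n k : nat) (U : 'M[R]_(n, k))
    (u : 'cV[R]_k) :
  dot u (Gfull U *m u) = \sum_j dot u (uvec U j) ^+ 2.
Proof.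
have -> : Gfull U = Gmat U (const_mx 1).
  by rewrite /Gmat trmx_const diag_const_mx mulmx1.
by rewrite dot_mul_Gmat; apply: eq_bigr => j _; rewrite mxE mulr1.
Qed.

Lemma dot_mul_Rmat (R : realType) (n k : nat) (U : 'M[R]_(n, k))
    (y : 'cV[R]_n) (u : 'cV[R]_k) :
  dot u (Rmat U y *m u) =
    dot u (Gmat U y *m u) - ybar y * dot u (Gfull U *m u)
    - mu U y * norm2 u ^+ 2.
Proof.
rewrite -dotvv /Rmat /Mmat !mulmxBl -scalemxAl mul_scalar_mx.
by rewrite /dot !mulmxBr -!scalemxAr !mxE.
Qed.

Lemma Hpartial_decomp (R : realType) (n k : nat) (U : 'M[R]_(n, k))
    (y : 'cV[R]_n) (i : 'I_n) :
  Hpartial U y i =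
    acoef U i + 2 * bcoef U i * ybar y + 2 * mu U y * dcoef U i
    - 2 * acoef U i * (y i 0 - ybar y)
    + 2 * dot (uvec U i) (Rmat U y *m uvec U i).
Proof.
rewrite dot_mul_Rmat dot_mul_Gmat dot_mul_Gfull.
(* Both forms contain the index [j = i], which [Hpartial] omits. Isolating it in each produces the
   correction in [y i 0 - ybar y]. *)
rewrite (bigD1 i) //= [X in ybar y * X](bigD1 i) //=.
have -> : dot (uvec U i) (uvec U i) ^+ 2 = acoef U i by rewrite dotvv -exprM.
by rewrite /Hpartial -/(dcoef U i) -/(bcoef U i); ring.
Qed.

(** * Coordinate lines in the full space and the derivative of [vtilde] *)

Lemma yblockE (R : realType) (p : nat) (N : 'I_p -> nat)
    (x : 'cV[R]_(\sum_(r < p) N r)) (r : 'I_p) (i : 'I_(N r)) :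
  yblock x r i 0 = 1 - x (tagnat.Rank r i) 0.
Proof. by rewrite !mxE. Qed.

Lemma yblock_add_basis (R : realType) (p : nat) (N : 'I_p -> nat)
    (x : 'cV[R]_(\sum_(r < p) N r)) (r : 'I_p) (i : 'I_(N r)) (t : R) :
  yblock (x + t *: basis_vec R i) r = yblock x r + - t *: delta_mx i 0.
Proof.
apply/matrixP => j k; rewrite (ord1 k) !mxE !eqxx !andbT.
have -> : (tagnat.Rank r j == tagnat.Rank r i) = (j == i).
  by rewrite (inj_eq tagnat.rank_inj) eq_Tagged.
by ring.
Qed.

Lemma yblock_add_basis_neq (R : realType) (p : nat) (N : 'I_p -> nat)
    (x : 'cV[R]_(\sum_(r < p) N r)) (r : 'I_p) (i : 'I_(N r)) (t : R)
    (s : 'I_p) :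
  s != r -> yblock (x + t *: basis_vec R i) s = yblock x s.
Proof.
move=> sr; apply/matrixP => j k; rewrite (ord1 k) !mxE !eqxx !andbT.
have /negPf -> : tagnat.Rank s j != tagnat.Rank r i.
  by apply: contra sr => /eqP/(congr1 tagnat.sig1); rewrite !tagnat.Rank1K => ->.
by rewrite mulr0 addr0.
Qed.

(** Only the factor of index [r] changes along this line. The minus sign of [y = 1 - x] cancels the
    one in front of the product. *)
Lemma vtilde_add_basis (R : realType) (p : nat) (N K : 'I_p -> nat)
    (U : forall r, 'M[R]_(N r, K r)) (x : 'cV[R]_(\sum_(r < p) N r))
    (r : 'I_p) (i : 'I_(N r)) (t : R) :
  vtilde U (x + t *: basis_vec R i) =
    vtilde U x + t * (gamma U x r * Hpartial (U r) (yblock x r) i).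
Proof.
rewrite /vtilde /gamma (bigD1 r) //= [in RHS](bigD1 r) //=.
rewrite yblock_add_basis Hpoly_add_delta.
rewrite (eq_bigr (fun s => Hpoly (U s) (yblock x s) / Zconst (U s))).
  by ring.
by move=> s sr; rewrite yblock_add_basis_neq.
Qed.

Local Open Scope classical_set_scope.

(** The difference quotient equals [c] at every nonzero [h], so its limit over the punctured
    neighbourhood is immediate. *)
Lemma is_derive_affine_line (R : realType) (V : normedModType R) (f : V -> R)
    (x v : V) (c : R) :
  (forall t, f (x + t *: v) = f x + t * c) -> is_derive x v f c.
Proof.
move=> fxv.
have fc : h^-1 *: ((f \o shift x) (h *: v) - f x) @[h --> (0 : R)^'] --> c.
  apply: cvg_near_cst; near=> h.
  rewrite /= [h *: v + x]addrC fxv [f x + _]addrC addrK /GRing.scale /= mulrA mulVf ?mul1r //.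
  by near: h; exact: nbhs_dnbhs_neq.
by apply: DeriveDef; [apply/cvg_ex; exists c|exact: cvg_lim fc].
Unshelve. all: by end_near. Qed.

Local Close Scope classical_set_scope.

(** * Signs on the cube and the final bound *)

Lemma Zconst_ge0 (R : realType) (n k : nat) (U : 'M[R]_(n, k)) :
  0 <= Zconst U.
Proof. by apply: sumr_ge0 => i _; apply: sumr_ge0 => j _; exact: sqr_ge0. Qed.

Lemma Hpoly_ge0 (R : realType) (n k : nat) (U : 'M[R]_(n, k)) (y : 'cV[R]_n) :
  (forall i, 0 <= y i 0) -> 0 <= Hpoly U y.
Proof.
move=> y0; rewrite /Hpoly addr_ge0 ?sumr_ge0 // => i _.
  by rewrite mulr_ge0 // exprn_ge0 ?norm2_ge0.
by apply: sumr_ge0 => j _; rewrite mulr_ge0 // mulr_ge0 // sqr_ge0.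
Qed.

(** This sign lets [2 * gamma U x r] leave the absolute value when the remainder is bounded. *)
Lemma gamma_ge0 (R : realType) (p : nat) (N K : 'I_p -> nat)
    (U : forall r, 'M[R]_(N r, K r)) (x : 'cV[R]_(\sum_(r < p) N r))
    (r : 'I_p) :
  (forall j, x j 0 <= 1) -> 0 <= gamma U x r.
Proof.
move=> x1; rewrite mulr_ge0 ?invr_ge0 ?Zconst_ge0 // prodr_ge0 // => s _.
rewrite divr_ge0 ?Zconst_ge0 // Hpoly_ge0 // => i.
by rewrite yblockE subr_ge0.
Qed.

Theorem lemma3 (R : realType) (p : nat) (hp : (1 <= p)%N)
    (N K : 'I_p -> nat) (hK : forall r, (1 <= K r)%N)
    (U : forall r, 'M[R]_(N r, K r))
    (hU : forall r, \rank (U r) = K r)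
    (x : 'cV[R]_(\sum_(r < p) N r))
    (hx : forall j, 0 <= x j 0 <= 1)
    (r : 'I_p) (i : 'I_(N r)) :
  [/\ derivable (vtilde U) x (basis_vec R i),
      gpartial U x i =
        qhat U x i
        + 2 * gamma U x r
          * dot (uvec (U r) i) (Rmat (U r) (yblock x r) *m uvec (U r) i),
      `|gpartial U x i - qhat U x i| <= rho_spec U x i
    & gpartial U x i \in
        `[qhat U x i - rho_spec U x i, qhat U x i + rho_spec U x i]].
Proof.
(* Kept in the context as an [is_derive] instance, from which [derive_val] reads off the partial
   derivative. *)
have dv := is_derive_affine_line (vtilde_add_basis U x i).
have gE : gpartial U x i = qhat U x i + 2 * gamma U x r
    * dot (uvec (U r) i) (Rmat (U r) (yblock x r) *m uvec (U r) i).
  by rewrite /gpartial derive_val Hpartial_decomp /qhat; ring.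
have gamma2_ge0 : 0 <= 2 * gamma U x r.
  by apply: mulr_ge0 => //; apply: gamma_ge0 => j; have /andP[] := hx j.
have g_le : `|gpartial U x i - qhat U x i| <= rho_spec U x i.
  rewrite gE addrC addKr normrM ger0_norm // /rho_spec -[leRHS]mulrA.
  by rewrite ler_wpM2l //; exact: quad_form_le_spectral_norm.
split=> //.
by rewrite in_itv /= -ler_distl.
Qed.
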